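(* Let $\mathfrak h_1,\mathfrak h_2$ be nonnegative sesquilinear forms in a complex Hilbert space $\mathfrak H$ with $\operatorname{dom}\mathfrak h_1=\operatorname{dom}\mathfrak h_2$ and sum $\mathfrak h=\mathfrak h_1+\mathfrak h_2$. Let $Q$ be a minimal representing map for $\mathfrak h$, i.e. a linear operator from $\mathfrak H$ to a Hilbert space $\mathfrak K$ with $\operatorname{dom}Q=\operatorname{dom}\mathfrak h$, $\overline{\operatorname{ran}}\,Q=\mathfrak K$, and $\mathfrak h[\varphi,\psi]=(Q\varphi,Q\psi)$ for $\varphi,\psi\in\operatorname{dom}\mathfrak h$. Let $K\in\mathbf B(\mathfrak K)$ be the nonnegative contraction for which $$\mathfrak h_1[\varphi,\psi]=((I-K)^{1/2}Q\varphi,(I-K)^{1/2}Q\psi),\qquad\mathfrak h_2[\varphi,\psi]=(K^{1/2}Q\varphi,K^{1/2}Q\psi),\qquad\varphi,\psi\in\operatorname{dom}\mathfrak h.$$ Then the following statements are equivalent: (i) the forms $\mathfrak h_1$ and $\mathfrak h_2$ are mutually singular; (ii) $K$ is an orthogonal projection.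
   Context: A (sesquilinear) form $\mathfrak h$ in $\mathfrak H$ is a map $\operatorname{dom}\mathfrak h\times\operatorname{dom}\mathfrak h\to\mathbb C$, linear in the first and antilinear in the second entry, where $\operatorname{dom}\mathfrak h$ is a (not necessarily dense) linear subspace of $\mathfrak H$; $\mathfrak h[\varphi]=\mathfrak h[\varphi,\varphi]$. It is nonnegative if $\mathfrak h[\varphi]\ge0$ on $\operatorname{dom}\mathfrak h$. A nonnegative contraction is a bounded everywhere defined selfadjoint operator $K$ on $\mathfrak K$ with $0\le K\le I$; a $K$ as in the claim always exists and, since $Q$ has dense range, is unique. The parallel sum of nonnegative forms $\mathfrak h_1,\mathfrak h_2$ with common domain $\operatorname{dom}\mathfrak h$ is the nonnegative form determined via polarization by $(\mathfrak h_1:\mathfrak h_2)[\varphi]=\inf\{\mathfrak h_1[h+\varphi]+\mathfrak h_2[h]:\ h\in\operatorname{dom}\mathfrak h\}$, $\varphi\in\operatorname{dom}\mathfrak h$. The forms $\mathfrak h_1$ and $\mathfrak h_2$ are called mutually singular if $\mathfrak h_1:\mathfrak h_2=0$. *)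

(* Defs.v *)
From HB Require Import structures.
From mathcomp Require Import all_boot all_order all_algebra.
From mathcomp Require Import complex.
From mathcomp Require Import all_classical all_reals.
From mathcomp Require Import topology normedtype.

Set Implicit Arguments.
Unset Strict Implicit.
Unset Printing Implicit Defensive.

Import Order.TTheory GRing.Theory Num.Theory.
Import numFieldNormedType.Exports.

Local Open Scope classical_set_scope.
Local Open Scope ring_scope.

(* [{dot V for Num.conj}] is linear in its first argument and antilinear in
   its second one. *)
HB.mixin Record CompleteNormedModule_isHilbert (R : realType) (V : Type)
    of CompleteNormedModule R[i] V := {
  inner : {dot V for @Num.conj R[i]} ;
  inner_norm : forall x : V, inner x x = `|x| ^+ 2
}.

#[short(type="hilbertType")]
HB.structure Definition Hilbert (R : realType) :=
  {V of CompleteNormedModule R[i] V & CompleteNormedModule_isHilbert R V}.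

(* The values of a form outside its domain are irrelevant. *)
Record sesqform (R : realType) (H : hilbertType R) := SesqForm {
  form_dom : {pred H} ;
  form_val :> H -> H -> R[i] ;
  form_dom_closed : submod_closed form_dom ;
  form_linearl : forall a, {in form_dom & &, forall u v w,
    form_val (a *: u + v) w = a * form_val u w + form_val v w} ;
  form_antilinearr : forall a, {in form_dom & &, forall u v w,
    form_val w (a *: u + v) = a^* * form_val w u + form_val w v}
}.

Section FormSum.
Variables (R : realType) (H : hilbertType R) (h1 h2 : sesqform H).

Let dom : {pred H} := [predI form_dom h1 & form_dom h2].
Let val (u v : H) := h1 u v + h2 u v.

Fact form_add_closed : submod_closed dom.
Proof.
have [z1 c1] := form_dom_closed h1; have [z2 c2] := form_dom_closed h2.
split=> [|a u v]; first by rewrite inE z1 z2.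
by rewrite !inE => /andP[u1 u2] /andP[v1 v2]; rewrite c1 // c2.
Qed.

Fact form_add_linearl a : {in dom & &, forall u v w,
  val (a *: u + v) w = a * val u w + val v w}.
Proof.
move=> u v w /andP[u1 u2] /andP[v1 v2] /andP[w1 w2].
by rewrite /val !form_linearl // mulrDr addrACA.
Qed.

Fact form_add_antilinearr a : {in dom & &, forall u v w,
  val w (a *: u + v) = a^* * val w u + val w v}.
Proof.
move=> u v w /andP[u1 u2] /andP[v1 v2] /andP[w1 w2].
by rewrite /val !form_antilinearr // mulrDr addrACA.
Qed.

Definition form_add : sesqform H :=
  SesqForm form_add_closed form_add_linearl form_add_antilinearr.

End FormSum.

Definition nonneg_form (R : realType) (H : hilbertType R) (h : sesqform H) :=
  {in form_dom h, forall u, 0 <= h u u}.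

(* The infimum is taken in [R]: the diagonal values of nonnegative forms are
   real, and [complex.Re] only casts them from [R[i]] to [R]. *)
Definition parallel_sum_diag (R : realType) (H : hilbertType R)
    (h1 h2 : sesqform H) (u : H) : R :=
  inf [set complex.Re (h1 (h + u) (h + u) + h2 h h)
      | h in [set` form_dom (form_add h1 h2)]].

(* Polarization of a quadratic form, for the convention "linear in the first
   argument, antilinear in the second one". *)
Definition polarize (R : realType) (H : hilbertType R) (q : H -> R)
    (u v : H) : R[i] :=
  4^-1 * \sum_(k < 4) 'i%C ^+ k * (q (u + 'i%C ^+ k *: v))%:C%C.

Definition parallel_sum (R : realType) (H : hilbertType R) (h1 h2 : sesqform H) :
    H -> H -> R[i] :=
  polarize (parallel_sum_diag h1 h2).

Definition mutually_singular (R : realType) (H : hilbertType R)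
    (h1 h2 : sesqform H) :=
  {in form_dom (form_add h1 h2) &, forall u v, parallel_sum h1 h2 u v = 0}.

(* A linear, not necessarily densely defined, not necessarily bounded operator;
   its values outside its domain are irrelevant. *)
Record linop (R : realType) (H K : hilbertType R) := Linop {
  op_dom : {pred H} ;
  op_val :> H -> K ;
  op_dom_closed : submod_closed op_dom ;
  op_linear : forall a, {in op_dom &, forall u v,
    op_val (a *: u + v) = a *: op_val u + op_val v}
}.

Definition minimal_representing_map (R : realType) (H K : hilbertType R)
    (h : sesqform H) (Q : linop H K) :=
  [/\ op_dom Q =i form_dom h,
      closure (Q @` [set` op_dom Q]) = [set: K] &
      {in form_dom h &, forall u v, h u v = inner (Q u) (Q v)}].

Definition bounded_selfadjoint (R : realType) (K : hilbertType R)
    (T : {linear K -> K}) :=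
  continuous T /\ forall x y, inner (T x) y = inner x (T y).

Definition nonneg_contraction (R : realType) (K : hilbertType R)
    (T : {linear K -> K}) :=
  bounded_selfadjoint T /\
  forall x, 0 <= inner (T x) x /\ inner (T x) x <= inner x x.

(* [S] is the unique bounded nonnegative selfadjoint operator with
   [S \o S = T]. *)
Definition is_nonneg_sqrt (R : realType) (K : hilbertType R)
    (T : K -> K) (S : {linear K -> K}) :=
  [/\ bounded_selfadjoint S,
      forall x, 0 <= inner (S x) x &
      forall x, S (S x) = T x].

Definition orthogonal_projection (R : realType) (K : hilbertType R)
    (P : {linear K -> K}) :=
  bounded_selfadjoint P /\ forall x, P (P x) = P x.

(* Main.v *)
(** Put y = Q φ.  Completing the square in x = Q h,
      ((I-K)(x+y), x+y) + (K x, x) = |x + (I-K)y|^2 + ((K - K^2)y, y),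
    and, the range of Q being dense, the square can be made arbitrarily small.
    So the parallel sum is (φ, ψ) |-> ((K - K^2) Q φ, Q ψ), which vanishes
    exactly when K - K^2 = 0. *)
Require Import Defs.
From HB Require Import structures.
From mathcomp Require Import all_boot all_order all_algebra.
From mathcomp Require Import complex.
From mathcomp Require Import all_classical all_reals.
From mathcomp Require Import topology normedtype.
From mathcomp Require Import ring.

Set Implicit Arguments.
Unset Strict Implicit.
Unset Printing Implicit Defensive.

Import Order.TTheory GRing.Theory Num.Theory.
Import numFieldNormedType.Exports.

Local Open Scope classical_set_scope.
Local Open Scope ring_scope.

Section HilbertSpace.
Variables (R : realType) (V : hilbertType R).
Implicit Types (x y : V) (D : set V) (T : {linear V -> V}).

(** Expanding, the terms in [(T x, x)], [(T y, x)] and [(T y, y)] carry factors whose sums over the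
    fourth roots of unity vanish; each term in [(T x, y)] has factor ['i ^+ k] times its conjugate,
    which is 1. *)
Lemma polarization_identity T x y :
  4^-1 * \sum_(k < 4)
    'i%C ^+ k * inner (T (x + 'i%C ^+ k *: y)) (x + 'i%C ^+ k *: y)
  = inner (T x) y.
Proof.
have conji : ('i%C : R[i])^* = - 'i%C.
  by rewrite -[LHS]/(conjc 'i%C); simpc.
have i2 : ('i%C : R[i]) * 'i%C = -1 by rewrite -expr2 sqr_i.
rewrite !big_ord_recl big_ord0 /= /bump /= !expr0 !expr1.
rewrite !(linearD, linearZ) /= !(linearDl, linearDr, linearZl_LR, linearZr_LR) /=.
rewrite !rmorphXn /= !rmorph1 conji.
have four : (4 : R[i]) != 0 by rewrite pnatr_eq0.
apply: (mulfI four); rewrite mulrA divff // mul1r.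
by ring: i2.
Qed.

Lemma innerC x y : inner x y = (inner y x)^*.
Proof. by rewrite [LHS]hermC expr0 mul1r. Qed.

Lemma pythagoras x y : inner x y = 0 -> `|x - y| ^+ 2 = `|x| ^+ 2 + `|y| ^+ 2.
Proof. by move=> xy0; rewrite -!inner_norm; exact: hnormBd. Qed.

Lemma dense_approx D x (e : R[i]) : closure D = [set: V] -> 0 < e ->
  exists2 d, D d & `|x - d| < e.
Proof.
move=> Ddense e_gt0.
have /(_ _ (nbhsx_ballx x e e_gt0)) [d [Dd]] : closure D x by rewrite Ddense.
by rewrite -ball_normE; exists d.
Qed.

(** If [x] were nonzero, some [d] in [D] would be closer to [x] than [|x|], whereas orthogonality
    gives [|x - d|^2 = |x|^2 + |d|^2]. *)
Lemma dense_orthogonal_eq0 D x : closure D = [set: V] ->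
  (forall d, D d -> inner x d = 0) -> x = 0.
Proof.
move=> Ddense xD; apply/eqP; rewrite -normr_eq0; apply: contraT => x_neq0.
have [|d Dd] := dense_approx x Ddense (e := `|x|).
  by rewrite lt0r x_neq0 normr_ge0.
rewrite -(ltr_pXn2r (n := 2)) ?nnegrE ?normr_ge0 //.
by rewrite pythagoras ?xD // => /lt_geF; rewrite lerDl exprn_ge0.
Qed.

End HilbertSpace.

(** The infimum need not be attained: the square vanishes only at [Q h = K y - y], which may lie
    outside the range of [Q]. Hence a lower bound is paired with an approximation. *)
Lemma parallel_sum_diagE (R : realType) (H : hilbertType R) (h1 h2 : sesqform H)
    (G : hilbertType R) (Q : linop H G) (K : {linear G -> G}) (u : H) :
    minimal_representing_map (form_add h1 h2) Q ->
    (forall x y, inner (K x) y = inner x (K y)) ->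
    {in form_dom (form_add h1 h2), forall u,
       h1 u u = inner (Q u - K (Q u)) (Q u)} ->
    {in form_dom (form_add h1 h2), forall u, h2 u u = inner (K (Q u)) (Q u)} ->
  u \in form_dom (form_add h1 h2) ->
  (parallel_sum_diag h1 h2 u)%:C%C = inner (K (Q u) - K (K (Q u))) (Q u).
Proof.
move=> [domQ ranQ _] K_sa h1E h2E u_dom.
have domD : {in form_dom (form_add h1 h2) &, forall v w,
    v + w \in form_dom (form_add h1 h2)}.
  by move=> v w v_dom w_dom; rewrite -[v]scale1r (form_dom_closed _).2.
have QD : {in form_dom (form_add h1 h2) &, {morph Q : v w / v + w}}.
  move=> v w v_dom w_dom.
  by rewrite -[in LHS](scale1r v) op_linear ?scale1r ?domQ.
set y := Q u; set c := inner _ y.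
(* Reality of [c] lets the identity in [R[i]] pass to the real infimum through [complex.Re]. *)
have c_real : c \is Num.real.
  by rewrite CrealE /c -innerC linearBr linearBl /= !K_sa.
have valE v : v \in form_dom (form_add h1 h2) ->
    h1 (v + u) (v + u) + h2 v v = `|Q v + y - K y| ^+ 2 + c.
  move=> v_dom; rewrite h1E ?domD // h2E // QD // -/y -inner_norm /c.
  rewrite !linearD /=.
  rewrite !(linearDl, linearDr, linearNl, linearNr, linearBl, linearBr) /=.
  rewrite !K_sa; ring.
rewrite -[RHS]RRe_real //; congr (_%:C)%C.
rewrite /parallel_sum_diag; set E := (X in inf X).
have ReE v : v \in form_dom (form_add h1 h2) ->
    complex.Re (h1 (v + u) (v + u) + h2 v v)
    = complex.Re (`|Q v + y - K y| ^+ 2) + complex.Re c.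
  by move=> v_dom; rewrite valE // raddfD.
have E_lb : lbound E (complex.Re c).
  move=> _ [v /= v_dom <-]; rewrite ReE // lerDr.
  by rewrite -ler0c RRe_real ?realX ?normr_real // exprn_ge0.
have E0 : E !=set0.
  by exists (complex.Re (h1 (u + u) (u + u) + h2 u u)), u.
apply/eqP; rewrite eq_le lb_le_inf // andbT.
apply/ler_addgt0Pr => e e_gt0.
(* The target makes [Q w + y - K y] small; the tolerance is a square root because this norm gets
   squared. *)
have [|_ [w w_dom <-]] := dense_approx (K y - y) ranQ (e := (Num.sqrt e)%:C%C).
  by rewrite ltcR sqrtr_gt0.
rewrite distrC opprB addrA => w_lt.
have {}w_dom : w \in form_dom (form_add h1 h2) by rewrite -domQ.
have /le_trans : inf E <= complex.Re (h1 (w + u) (w + u) + h2 w w).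
  by apply: ge_inf; [exists (complex.Re c) | exists w].
apply; rewrite ReE // [leRHS]addrC lerD2r -lecR RRe_real ?realX ?normr_real //.
rewrite -(sqr_sqrtr (ltW e_gt0)) rmorphXn.
by rewrite lerXn2r ?nnegrE ?normr_ge0 ?ler0c ?sqrtr_ge0 // ltW.
Qed.

Theorem corollary4p5 (R : realType) (H : hilbertType R) (h1 h2 : sesqform H)
    (h1_ge0 : nonneg_form h1) (h2_ge0 : nonneg_form h2)
    (eq_dom : form_dom h1 =i form_dom h2)
    (G : hilbertType R) (Q : linop H G)
    (Qrep : minimal_representing_map (form_add h1 h2) Q)
    (K : {linear G -> G}) (K_contr : nonneg_contraction K)
    (sqrtIK sqrtK : {linear G -> G})
    (sqrtIKP : is_nonneg_sqrt (fun x => x - K x) sqrtIK)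
    (sqrtKP : is_nonneg_sqrt K sqrtK)
    (h1E : {in form_dom (form_add h1 h2) &, forall u v,
       h1 u v = inner (sqrtIK (Q u)) (sqrtIK (Q v))})
    (h2E : {in form_dom (form_add h1 h2) &, forall u v,
       h2 u v = inner (sqrtK (Q u)) (sqrtK (Q v))}) :
  mutually_singular h1 h2 <-> orthogonal_projection K.
Proof.
have [K_bsa _] := K_contr; have [_ K_sa] := K_bsa.
have [[_ sIK_sa] _ sIKE] := sqrtIKP; have [[_ sK_sa] _ sKE] := sqrtKP.
pose T : {linear G -> G} := K \- (K \o K).
have diagE u : u \in form_dom (form_add h1 h2) ->
    (parallel_sum_diag h1 h2 u)%:C%C = inner (T (Q u)) (Q u).
  move=> u_dom; apply: parallel_sum_diagE => // v v_dom.
  (* Selfadjointness moves the second square root to the first entry, where the two compose to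
     [I - K], respectively [K]. *)
  - by rewrite h1E // -sIK_sa sIKE.
  - by rewrite h2E // -sK_sa sKE.
have [domQ ranQ _] := Qrep.
have parallelE : {in form_dom (form_add h1 h2) &, forall u v,
    parallel_sum h1 h2 u v = inner (T (Q u)) (Q v)}.
  (* Both sides are now polarizations, so comparing diagonal values term by term suffices. *)
  move=> u v u_dom v_dom; rewrite -polarization_identity.
  congr (_ * _); apply: eq_bigr => k _; congr (_ * _).
  have QD a : Q (u + a *: v) = Q u + a *: Q v.
    by rewrite addrC op_linear ?domQ // addrC.
  rewrite diagE ?QD //.
  by rewrite addrC (form_dom_closed _).2.
split=> [singular | [_ KK]]; last first.
  by move=> u v u_dom v_dom; rewrite parallelE //= KK subrr linear0l.
(* Density serves twice: first [T] vanishes on the range of [Q]; then, [T] being symmetric, [T x] is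
   orthogonal to that range for every [x]. *)
split=> // x; apply/esym/eqP; rewrite -subr_eq0.
apply/eqP; apply: (dense_orthogonal_eq0 ranQ) => _ [v /= v_dom <-].
have {}v_dom : v \in form_dom (form_add h1 h2) by rewrite -domQ.
have TQv0 : T (Q v) = 0.
  apply: (dense_orthogonal_eq0 ranQ) => _ [w /= w_dom <-].
  by rewrite -parallelE ?singular // -domQ.
have -> : inner (K x - K (K x)) (Q v) = inner x (T (Q v)).
  by rewrite /= linearBl linearBr /= !K_sa.
by rewrite TQv0 linear0r.
Qed.
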